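(* Let $\tau\mid n$ and $M:=n/\tau$. Assume that either $M=3$, or $M$ is even and $M\ge4$, or $M$ is odd and $M\ge5$. Then: (a) If $\mathcal N$ is a binary necklace of length $n$ with $K_2(\mathcal N)=\tau(\mathbb Z/n\mathbb Z)\setminus\{0\}$, then $\delta(\mathcal N)=2$ and, for every representative of $\mathcal N$, the set of $1$'s on the unique active $\tau$-orbit has size $1$ or $M-1$. Moreover there is a unique representative $w\in\mathcal N$ of the form $w=w(c)$ with $c\in\{0,1\}^\tau$ (single-defect normal form relative to the shift $\tau$), and the associated word $c\in\{0,1\}^\tau$ is unique and primitive. (b) The assignment $c\mapsto [w(c)]$ is a bijection from the set of primitive words $c\in\{0,1\}^\tau$ onto $$\begin{cases}\mathcal D_2^{\mathrm{SP}}(n;3),& M=3,\\ \mathcal D_2^{\mathrm{HT}}(n;\tau),& M\text{ even},\ M\ge4,\\ \mathcal D_2^{\mathrm{SUB}}(n;\tau),& M\text{ odd},\ M\ge5.\end{cases}$$ In particular, if $c,c'\in\{0,1\}^\tau$ are primitive words with $[w(c)]=[w(c')]$ then $c=c'$ (necklace equivalence imposes no additional quotient).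
   Context: Words $w\in\{0,1\}^n$ are indexed by $\mathbb Z/n\mathbb Z$; $(\mathrm{rot}^k w)_i=w_{i-k}$; a binary necklace of length $n$ is a rotation orbit $[w]$. A word is primitive if no nonzero rotation fixes it (for length $1$, both words are primitive). $d_w(k)=|\{i:w_i\ne w_{i-k}\}|$; for $n\ge2$, $\delta(w)=\min_{1\le k\le n-1}d_w(k)$ and $K_2(w)=\{k\in\{1,\dots,n-1\}:d_w(k)=2\}$, viewed in $\mathbb Z/n\mathbb Z\setminus\{0\}$; these depend only on the necklace. $\tau(\mathbb Z/n\mathbb Z)\setminus\{0\}$ is the set of nonzero residues represented by multiples of $\tau$. Active orbit: the $\tau$-orbits are the cosets $r+\tau(\mathbb Z/n\mathbb Z)$, $0\le r<\tau$. When $d_w(\tau)=2$, exactly one $\tau$-orbit is such that $w$ is nonconstant on it; it is called the active $\tau$-orbit. Single-defect word: for $c=(c_0,\dots,c_{\tau-1})\in\{0,1\}^\tau$, $w(c)\in\{0,1\}^n$ is given by $w_0=1-c_0$, $w_{t\tau}=c_0$ for $1\le t\le M-1$, and $w_{r+t\tau}=c_r$ for $1\le r\le\tau-1$, $0\le t\le M-1$. Classes: $\mathcal D_2(n)$ is the set of necklaces of length $n$ with $\delta=2$. $\mathcal D_2^{\mathrm{SP}}(n;3)$ (for $3\mid n$): $\mathcal N\in\mathcal D_2(n)$ with $K_2(\mathcal N)=\{k,n-k\}$ for some $1\le k<n/2$, where $k$ has order $3$ in $\mathbb Z/n\mathbb Z$. $\mathcal D_2^{\mathrm{HT}}(n;\tau)$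 ($n$ even, $\tau\mid n/2$): $\mathcal N\in\mathcal D_2(n)$ with $n/2\in K_2(\mathcal N)$ and $K_2(\mathcal N)=\tau(\mathbb Z/n\mathbb Z)\setminus\{0\}$. $\mathcal D_2^{\mathrm{SUB}}(n;\tau)$: $\mathcal N\in\mathcal D_2(n)$ with $K_2(\mathcal N)=\tau(\mathbb Z/n\mathbb Z)\setminus\{0\}$, $|K_2(\mathcal N)|>2$ and, if $n$ is even, $n/2\notin K_2(\mathcal N)$. *)

(* Defs.v *)
From mathcomp Require Import all_boot all_order all_algebra all_fingroup.

Set Implicit Arguments.
Unset Strict Implicit.
Unset Printing Implicit Defensive.

Import GRing.Theory.
Local Open Scope ring_scope.

(* Only ['I_m.+1] carries the additive group structure of Z/(m+1)Z, so lengths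
   are successors throughout: [word m] is the set of words of length m.+1,
   indexed by Z/(m+1)Z (length 1 included). *)
Definition word (m : nat) := {ffun 'I_m.+1 -> bool}.

Section Words.
Variable m : nat.
Implicit Types (w : word m) (k : 'I_m.+1).

Definition rotw k w : word m := [ffun i => w (i - k)].

Definition necklace_of w : {set word m} := [set rotw k w | k : 'I_m.+1].

Definition necklaces : {set {set word m}} := [set necklace_of w | w : word m].

Definition primitive w : bool := [forall k, (k != 0) ==> (rotw k w != w)].

Definition dist w k : nat := #|[set i | w i != w (i - k)]|.

(* The default value m.+1 bounds every [dist w k], so for length at least 2
   this is the minimum over the nonzero shifts. *)
Definition delta w : nat := \big[minn/m.+1]_(k : 'I_m.+1 | k != 0) dist w k.

Definition K2 w : {set 'I_m.+1} := [set k | (k != 0) && (dist w k == 2%N)].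

(* [delta] and [K2] are rotation invariant, so on a necklace they may be read
   off any representative: see [deltaN_necklace_of] and [K2N_necklace_of]. *)
Definition representative (N : {set word m}) : word m :=
  odflt [ffun=> false] [pick w in N].
Definition deltaN (N : {set word m}) : nat := delta (representative N).
Definition K2N (N : {set word m}) : {set 'I_m.+1} := K2 (representative N).

Lemma dist_rotw k w j : dist (rotw k w) j = dist w j.
Proof.
rewrite /dist -[RHS](card_imset _ (@addIr _ k)); congr #|pred_of_set _|.
apply/setP=> i; rewrite inE !ffunE; apply/idP/imsetP.
  by move=> ne; exists (i - k); rewrite ?subrK // inE addrAC.
case=> i'; rewrite inE => ne ->; rewrite addrK.
by have -> : i' + k - j - k = i' - j by rewrite addrAC addrK.
Qed.

Lemma representative_necklace_of w :
  exists k, representative (necklace_of w) = rotw k w.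
Proof.
rewrite /representative; case: pickP => [w' /imsetP[k _ ->]|/(_ (rotw 0 w))].
  by exists k.
by rewrite /= (imset_f (rotw^~ w)).
Qed.

Lemma deltaN_necklace_of w : deltaN (necklace_of w) = delta w.
Proof.
have [k ek] := representative_necklace_of w.
by rewrite /deltaN ek; apply: eq_bigr => j _; apply: dist_rotw.
Qed.

Lemma K2N_necklace_of w : K2N (necklace_of w) = K2 w.
Proof.
have [k ek] := representative_necklace_of w.
by rewrite /K2N ek; apply/setP=> j; rewrite !inE dist_rotw.
Qed.

Definition multiples (tau : nat) : {set 'I_m.+1} :=
  [set z *+ tau | z : 'I_m.+1].

Definition tau_orbits (tau : nat) : {set {set 'I_m.+1}} :=
  [set [set r + z | z in multiples tau] | r : 'I_m.+1].

Definition nonconstant_on (O : {set 'I_m.+1}) w : bool :=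
  [exists i in O, exists j in O, w i != w j].

Definition active_orbits (tau : nat) w : {set {set 'I_m.+1}} :=
  [set O in tau_orbits tau | nonconstant_on O w].

(* The cases w_{t tau} = c_0 (t >= 1) and w_{r + t tau} = c_r (r >= 1) are
   together w_i = c_{i mod tau} for i <> 0; here tau = t.+1, and [inZp] is
   reduction modulo tau. *)
Definition single_defect (t : nat) (c : word t) : word m :=
  [ffun i : 'I_m.+1 => if i == 0 then ~~ c 0 else c (inZp i)].

Definition D2 : {set {set word m}} := [set N in necklaces | deltaN N == 2%N].

(* Here [#[k]%g] is the order of k in the additive group Z/(m+1)Z, and [- k]
   is the residue m.+1 - k. *)
Definition D2SP3 : {set {set word m}} :=
  [set N in D2 | [exists k : 'I_m.+1,
    [&& (1 <= k)%N, (k.*2 < m.+1)%N, K2N N == [set k; - k] & #[k]%g == 3%N]]].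

Definition D2HT (tau : nat) : {set {set word m}} :=
  [set N in D2 | [&& ~~ odd m.+1, (tau %| (m.+1)./2)%N,
    inZp (m.+1)./2 \in K2N N & K2N N == multiples tau :\ 0]].

Definition D2SUB (tau : nat) : {set {set word m}} :=
  [set N in D2 | [&& K2N N == multiples tau :\ 0, (2 < #|K2N N|)%N
    & ~~ odd m.+1 ==> (inZp (m.+1)./2 \notin K2N N)]].

End Words.

Arguments single_defect m {t} c.

(* Main.v *)
Require Import Defs.
From mathcomp Require Import all_boot all_order all_algebra all_fingroup.
From mathcomp Require Import cyclic zify.

Set Implicit Arguments.
Unset Strict Implicit.
Unset Printing Implicit Defensive.

Import GRing.Theory.
Local Open Scope ring_scope.

(* Both tau and 2 tau lie in K_2, so w differs from its tau-shift at exactly two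
   places, and comparison with the 2 tau-shift forces these to be a and a + tau.
   Flipping the letter at a thus makes w tau-periodic, i.e. w is w(c) rotated by
   a.  Conversely w(c) differs from the periodic extension of c only at 0: a shift
   k with c fixed by rotation by k mod tau has d = 2, while for any other k the
   word c has at least two mismatches, each repeated M >= 3 times, of which the
   defect spoils at most two, so d > 2.  Hence K_2(w(c)) consists of the nonzero
   multiples of tau iff c is primitive.  The normal form is unique because the
   mismatches of w(c) under the shift tau are at 0 and tau, and 2 tau <> 0.  The
   three target classes all equal {N | K_2(N) = tau(Z/n) \ 0}. *)

(** * Rotations, necklaces and mismatch sets *)

Section Rotation.
Variable m : nat.
Implicit Types (w : word m) (k : 'I_m.+1).

Lemma rotw0 w : rotw 0 w = w.
Proof. by apply/ffunP=> i; rewrite ffunE subr0. Qed.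

Lemma rotwD j k w : rotw j (rotw k w) = rotw (j + k) w.
Proof. by apply/ffunP=> i; rewrite !ffunE opprD addrA. Qed.

Lemma mem_necklace_of w : w \in necklace_of w.
Proof. by apply/imsetP; exists 0; rewrite ?rotw0. Qed.

Lemma necklace_of_rotw k w : necklace_of (rotw k w) = necklace_of w.
Proof.
apply/setP=> v; apply/imsetP/imsetP=> -[j _ ->].
  by exists (j + k); rewrite ?rotwD.
by exists (j - k); rewrite ?rotwD ?subrK.
Qed.

Definition defects w k : {set 'I_m.+1} := [set i | w i != w (i - k)].

Lemma defects_rotw j k w : defects (rotw j w) k = [set j + i | i in defects w k].
Proof.
apply/setP=> i; apply/idP/imsetP=> [|[i0]]; rewrite inE.
  rewrite !ffunE => ne; exists (i - j); first by rewrite inE addrAC.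
  by rewrite addrC subrK.
by move=> ne ->; rewrite inE !ffunE [j + i0]addrC addrK addrAC addrK.
Qed.

(* Rising and falling steps w (i - k) -> w i are equinumerous. *)
Lemma odd_dist w k : odd (dist w k) = false.
Proof.
pose A := [set i | w i]; pose B := [set i | w (i - k)].
have AB : #|A| = #|B|.
  rewrite -(card_imset A (@addIr _ k)); apply: eq_card => i.
  apply/imsetP/idP=> [[j]|]; rewrite inE => wi; first by move=> ->; rewrite inE addrK.
  by exists (i - k); rewrite ?subrK // inE.
have -> : dist w k = (#|A :\: B| + #|B :\: A|)%N.
  rewrite /dist -cardsUI -[LHS]addn0; congr (_ + _)%N.
    by apply: eq_card => i; rewrite !inE; do 2!case: (w _).
  by apply/esym/eqP; rewrite cards_eq0; apply/eqP/setP=> i; rewrite !inE; do 2!case: (w _).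
have := cardsID B A; have := cardsID A B; rewrite setIC AB => <- /addnI ->.
by rewrite addnn odd_double.
Qed.

End Rotation.

(** * Fibres of reduction modulo tau *)

Section Fibers.
Variables m t : nat.
Hypothesis tau_n : (t.+1 %| m.+1)%N.
Let M := (m.+1 %/ t.+1)%N.
Implicit Types (w : word m) (c : word t) (i j k a : 'I_m.+1) (r : 'I_t.+1).

Let nE : m.+1 = (M * t.+1)%N. Proof. by rewrite divnK. Qed.

Definition residue i : 'I_t.+1 := inZp i.
Definition lift_residue r : 'I_m.+1 := inZp r.
Definition step : 'I_m.+1 := inZp t.+1.

Lemma lift_residueK : cancel lift_residue residue.
Proof. by move=> r; apply: val_inj; rewrite /= modn_dvdm // modn_small. Qed.

Lemma residueD i j : residue (i + j) = residue i + residue j.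
Proof. by apply: val_inj; rewrite /= modn_dvdm // modnDm. Qed.

Lemma residueB i j : residue (i - j) = residue i - residue j.
Proof. by apply: (@addIr _ (residue j)); rewrite -residueD !subrK. Qed.

Lemma residue_eq0 i : (residue i == 0) = (t.+1 %| i)%N.
Proof. by []. Qed.

Lemma residue0 : residue 0 = 0.
Proof. by apply: val_inj; rewrite /= mod0n. Qed.

Lemma residue_step : residue step = 0.
Proof. by apply: val_inj; rewrite /= modn_dvdm // modnn. Qed.

(** Since tau divides n, reduction modulo tau is a morphism on Z/n, and the multiples of tau form
    its kernel. *)
Lemma multiplesE i : (i \in multiples m t.+1) = (residue i == 0).
Proof.
rewrite residue_eq0; apply/imsetP/idP=> [[z _ ->]|tau_i].
  by rewrite Zp_mulrn /= /dvdn modn_dvdm // modnMl.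
exists (inZp (i %/ t.+1)) => //; apply: val_inj.
by rewrite Zp_mulrn /= modnMml divnK // modn_small.
Qed.

Lemma residue0_step i : residue i = 0 -> exists k : nat, i = step *+ k.
Proof.
move/eqP; rewrite -multiplesE => /imsetP[z _ ->]; exists z.
by rewrite !Zp_mulrn; apply: val_inj; rewrite /= modnMml mulnC.
Qed.

(** The fibres are translates of one another, hence equal in size, and the tau of them partition the
    n positions. *)
Lemma card_residue r : #|[set i | residue i == r]| = M.
Proof.
have fib s : #|[set i | residue i == s]| = #|[set i | residue i == 0]|.
  rewrite -[RHS](card_imset _ (@addIr _ (lift_residue s))); apply: eq_card => i.
  apply/idP/imsetP=> [|[j]]; rewrite !inE.
    move/eqP=> rs; exists (i - lift_residue s); rewrite ?subrK //.
    by rewrite inE residueB rs lift_residueK subrr.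
  by move=> /eqP rj ->; rewrite residueD rj lift_residueK add0r.
have: (\sum_(s : 'I_t.+1) #|[set i | residue i == s]|)%N = m.+1.
  rewrite -[RHS]card_ord -sum1_card (partition_big residue xpredT) //=.
  by apply: eq_bigr => s _; rewrite sum1dep_card.
rewrite (eq_bigr (fun=> #|[set i | residue i == r]|)) => [|s _]; last by rewrite !fib.
rewrite sum_nat_const card_ord => E; apply/eqP.
by rewrite -(eqn_pmul2l (ltn0Sn t)) E mulnC divnK.
Qed.

Lemma card_residue_in (A : {set 'I_t.+1}) : #|[set i | residue i \in A]| = (#|A| * M)%N.
Proof.
rewrite -sum1dep_card (partition_big residue (mem A)) //=.
rewrite (eq_bigr (fun=> M)) ?sum_nat_const // => r rA.
rewrite -(card_residue r) -sum1dep_card; apply: eq_bigl => i.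
by case: eqP => [->|]; rewrite ?andbF ?rA.
Qed.

(** * Shift distances of single-defect words *)

(** The xor form separates the tau-periodic extension of [c] from the toggle at 0, so that
    mismatches reduce to boolean cancellation. *)
Lemma single_defectE c i : single_defect m c i = c (residue i) (+) (i == 0).
Proof.
rewrite ffunE; case: eqP => [->|_]; last by rewrite addbF.
by rewrite residue0 addbT.
Qed.

Lemma defects_single_defect c k : k != 0 -> rotw (residue k) c = c ->
  defects (single_defect m c) k = [set 0; k].
Proof.
move=> k0 ck; apply/setP=> i; rewrite !inE !single_defectE residueB subr_eq0.
have -> : c (residue i - residue k) = c (residue i) by rewrite -{2}ck ffunE.
case: (i =P 0) => [->|_]; last by case: (i == k); case: (c _).
by rewrite [0 == k]eq_sym (negPf k0); case: (c _).
Qed.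

Lemma dist_single_defect_periodic c k : k != 0 -> rotw (residue k) c = c ->
  dist (single_defect m c) k = 2%N.
Proof.
move=> k0 ck; rewrite /dist -/(defects _ _) defects_single_defect //.
by rewrite cards2 eq_sym k0.
Qed.

Hypothesis M_ge3 : (2 < M)%N.

Lemma step_neq0 : step != 0.
Proof.
by rewrite -val_eqE /= modn_small // nE ltn_Pmull // ltnW.
Qed.

Lemma step2_neq0 : step *+ 2 != 0.
Proof.
by rewrite Zp_mulrn -val_eqE /= modnMml modn_small // nE mulnC ltn_pmul2r.
Qed.

(** Evenness of the distance turns one mismatch of [c] into at least two; their fibres contain at
    least 2M >= 6 positions, of which only 0 and [k] can be lost. *)
Lemma dist_single_defect_aperiodic c k : rotw (residue k) c != c ->
  (2 < dist (single_defect m c) k)%N.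
Proof.
move=> ck.
have d2 : (1 < dist c (residue k))%N.
  have : dist c (residue k) != 0%N.
    apply: contra ck; rewrite cards_eq0 => /eqP D0; apply/eqP/ffunP=> r.
    by rewrite ffunE; move/setP/(_ r): D0; rewrite !inE => /negbFE/eqP.
  by have := odd_dist c (residue k); case: dist => [|[|]].
pose A := [set i | residue i \in [set r | c r != c (r - residue k)]].
have AM : #|A| = (dist c (residue k) * M)%N by rewrite card_residue_in.
have sA : A \subset [set 0; k] :|: defects (single_defect m c) k.
  apply/subsetP=> i; rewrite !inE !single_defectE residueB subr_eq0.
  by case: (i == 0); case: (i == k); rewrite ?addbF.
have: (#|A| <= 2 + dist (single_defect m c) k)%N.
  apply: leq_trans (leq_trans (subset_leq_card sA) (leq_card_setU _ _)) _.
  by rewrite leq_add2r cards2; case: (0 != k).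
by rewrite AM; nia.
Qed.

Lemma K2_single_defect c :
  (K2 (single_defect m c) == multiples m t.+1 :\ 0) = primitive c.
Proof.
apply/eqP/forallP=> [K r|pc].
  apply/implyP; apply: contra => /eqP cr.
  (* A period [r] of [c] is tested through its lift, which is a shift in [K2] unless it vanishes; in
     that case [r] is already 0. *)
  have [k0|k0] := eqVneq (lift_residue r) 0.
    by rewrite -[r]lift_residueK k0 residue0.
  have: lift_residue r \in K2 (single_defect m c).
    by rewrite inE k0 dist_single_defect_periodic ?lift_residueK.
  by rewrite K !inE multiplesE lift_residueK => /andP[].
apply/setP=> k; rewrite !inE multiplesE.
have [//|k0 /=] := eqVneq k 0.
have [rk|rk] := eqVneq (residue k) 0.
  by rewrite dist_single_defect_periodic ?rk ?rotw0.
have /dist_single_defect_aperiodic := implyP (pc (residue k)) rk.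
by case: eqP => // ->.
Qed.

Lemma delta_single_defect c : primitive c -> delta (single_defect m c) = 2%N.
Proof.
move=> pc; apply/eqP; rewrite eqn_leq; apply/andP; split.
  rewrite -(@dist_single_defect_periodic c step) ?step_neq0 //; last first.
    by rewrite residue_step rotw0.
  rewrite /delta -minEnat -leEnat.
  exact: (Order.TotalTheory.bigmin_le_cond _ (dist (single_defect m c)) step_neq0).
rewrite /delta; apply: (big_ind (leq 2)) => [|x y x2 y2|k k0].
(* The default [m.+1] of the minimum must be at least 2 as well; it is, since n >= M >= 3. *)
- by rewrite nE; nia.
- by rewrite leq_min x2.
have [ck|/dist_single_defect_aperiodic/ltnW //] := eqVneq (rotw (residue k) c) c.
by rewrite dist_single_defect_periodic.
Qed.

(** * Uniqueness of the normal form *)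

(** Under the shift [step] the mismatches are 0 and [step]; rotation moves them to [k] and
    [k + step]. The only alternative to [k = 0] is [k = step], which would put [step *+ 2] in
    [[set 0; step]]. *)
Lemma single_defect_rotw k c c' :
  rotw k (single_defect m c) = single_defect m c' -> k = 0.
Proof.
move=> /(congr1 (fun w : word m => defects w step)).
rewrite defects_rotw !defects_single_defect ?step_neq0 ?residue_step ?rotw0 //.
move=> E; have: k \in [set 0; step].
  by rewrite -E; apply/imsetP; exists 0; rewrite ?addr0 // !inE eqxx.
have: k + step \in [set 0; step].
  by rewrite -E; apply/imsetP; exists step; rewrite // !inE eqxx orbT.
rewrite !inE => /[swap] /orP[/eqP //|/eqP ->].
by rewrite -mulr2n (negPf step2_neq0) mulr2n -subr_eq0 addrK (negPf step_neq0).
Qed.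

Lemma single_defect_inj : injective (single_defect m (t := t)).
Proof.
move=> c c' E; apply/ffunP=> r.
(* A second position in the fibre of [r] is read because the first may be 0, the toggled one. *)
have := congr1 (fun w : word m => w (lift_residue r + step)) E.
have := congr1 (fun w : word m => w (lift_residue r)) E.
rewrite !single_defectE residueD residue_step addr0 lift_residueK.
have [-> _|_] := eqVneq (lift_residue r) 0; last by rewrite !addbF.
by rewrite add0r (negPf step_neq0) !addbF.
Qed.

(** * Recovering the normal form from the mismatches *)

(* The defects of the shift 2 tau are the symmetric difference of those of the
   shift tau and their translate by tau; both have two elements, so they share
   exactly one. *)
Lemma consecutive_defects w : dist w step = 2%N -> dist w (step *+ 2) = 2%N ->
  exists a, defects w step = [set a; a + step].
Proof.
rewrite /dist -!/(defects _ _) => d1 d2.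
have [E|/set0Pn[b]] :=
    eqVneq (defects w step :&: [set i + step | i in defects w step]) set0.
  have : (4 <= #|defects w (step *+ 2)|)%N.
    have := cardsUI (defects w step) [set i + step | i in defects w step].
    rewrite E cards0 addn0 (card_imset _ (@addIr _ step)) d1 addn2 => <-.
    apply/subset_leq_card/subsetP=> i.
    have iD : (i \in [set i + step | i in defects w step]) = (i - step \in defects w step).
      apply/imsetP/idP=> [[j jD ->]|iD]; first by rewrite addrK.
      by exists (i - step); rewrite ?subrK.
    have: i \in defects w step :&: [set i + step | i in defects w step] = false.
      by rewrite E inE.
    rewrite inE in_setU iD !inE mulr2n opprD addrA.
    by do 3!case: (w _).
  by rewrite d2.
rewrite inE => /andP[bD /imsetP[a aD bE]]; exists a; apply/esym/eqP.
rewrite eqEcard d1 cards2 -subr_eq0 opprD addrA subrr add0r oppr_eq0 step_neq0 andbT.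
by apply/subsetP=> i; rewrite !in_set2 => /orP[]/eqP-> //; rewrite -bE.
Qed.

Lemma single_defect_of_defects w a : defects w step = [set a; a + step] ->
  exists c : word t, w = rotw a (single_defect m c).
Proof.
(* [v] is [w] moved back by [a] with its letter at 0 toggled; the toggle cancels both mismatches, so
   [v] is invariant under [step]. *)
move=> E; pose v i := w (i + a) (+) (i == 0).
have vT i : v (i - step) = v i.
  have: (i + a \in defects w step) = (i == 0) || (i == step).
    rewrite E !inE [a + step]addrC (inj_eq (addIr a)).
    by rewrite -[X in i + a == X]add0r (inj_eq (addIr a)).
  rewrite inE /v subr_eq0 [i - step + a]addrAC.
  have [->|_] := eqVneq i 0; last by case: (i == step); do 2!case: (w _).
  by rewrite [0 == step]eq_sym (negPf step_neq0); do 2!case: (w _).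
have vTn (q : nat) i : v (i - step *+ q) = v i.
  by elim: q => [|q IH]; rewrite ?mulr0n ?subr0 // mulrS opprD addrA addrAC vT.
have vr i j : residue i = residue j -> v i = v j.
  move=> rij; have /residue0_step[k kE] : residue (i - j) = 0.
    by rewrite residueB rij subrr.
  by rewrite -(vTn k i) -kE opprB addrC subrK.
exists [ffun r => v (lift_residue r)]; apply/ffunP=> i.
rewrite ffunE single_defectE ffunE (vr _ (i - a)) ?lift_residueK //.
by rewrite /v subrK; case: (w i); case: eqP.
Qed.

(** The shifts [step] and [step *+ 2] produce [c]; the full equality for [K2] then yields its
    primitivity. *)
Lemma K2_necklace w : K2 w = multiples m t.+1 :\ 0 ->
  exists2 c : word t, primitive c & necklace_of w = necklace_of (single_defect m c).
Proof.
move=> K; have KP k : k != 0 -> residue k = 0 -> dist w k = 2%N.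
  move=> k0 rk; have : k \in K2 w by rewrite K !inE k0 multiplesE rk eqxx.
  by rewrite inE => /andP[_ /eqP].
have r2 : residue (step *+ 2) = 0 by rewrite mulr2n residueD residue_step addr0.
have [a /single_defect_of_defects[c wE]] :=
  consecutive_defects (KP _ step_neq0 residue_step) (KP _ step2_neq0 r2).
have Nw : necklace_of w = necklace_of (single_defect m c).
  by rewrite wE necklace_of_rotw.
by exists c; rewrite // -K2_single_defect -K2N_necklace_of -Nw K2N_necklace_of K.
Qed.

(** * The active orbit *)

Lemma tau_orbitE i : [set i + z | z in multiples m t.+1] = [set j | residue j == residue i].
Proof.
apply/setP=> j; rewrite inE; apply/imsetP/eqP=> [[z]|rj].
  by rewrite multiplesE => /eqP z0 ->; rewrite residueD z0 addr0.
by exists (j - i); rewrite ?multiplesE ?residueB ?rj ?subrr // addrC subrK.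
Qed.

Lemma rotw_single_defectE a c i :
  rotw a (single_defect m c) i = c (residue i - residue a) (+) (i == a).
Proof. by rewrite ffunE single_defectE residueB subr_eq0. Qed.

(** An orbit that avoids [a] sees only the periodic part; the orbit of [a] contains [a + step],
    whose letter differs from that at [a]. *)
Lemma active_orbits_rotw_single_defect a c :
  active_orbits t.+1 (rotw a (single_defect m c)) = [set [set i | residue i == residue a]].
Proof.
apply/setP=> O; rewrite !inE; apply/andP/eqP=> [[/imsetP[b _ ->]]|->].
  rewrite tau_orbitE => /exists_inP[i]; rewrite inE => /eqP ri /exists_inP[j].
  rewrite inE => /eqP rj; rewrite !rotw_single_defectE ri rj.
  have [ia|_] := eqVneq i a; first by rewrite -ri ia.
  have [ja|_] := eqVneq j a; first by rewrite -rj ja.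
  by rewrite eqxx.
split; first by apply/imsetP; exists a; rewrite ?tau_orbitE.
apply/exists_inP; exists a; first by rewrite inE.
apply/exists_inP; exists (a + step); first by rewrite inE residueD residue_step addr0.
rewrite !rotw_single_defectE residueD residue_step addr0 eqxx.
rewrite -[a + step == a]subr_eq0 [a + step - a]addrAC !subrr add0r.
by rewrite (negPf step_neq0); case: (c _).
Qed.

(** On the active orbit every letter is [c 0] except at [a], so the ones are [a] alone or the rest
    of the orbit, according to [c 0]. *)
Lemma card_ones_active_orbit a c :
  let ones := [set i in [set i | residue i == residue a] | rotw a (single_defect m c) i] in
  #|ones| = 1%N \/ #|ones| = M.-1.
Proof.
have sE i : residue i == residue a ->
    rotw a (single_defect m c) i = c 0 (+) (i == a).
  by move=> /eqP ri; rewrite rotw_single_defectE ri subrr.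
case c0: (c 0); [right | left].
  rewrite -(card_residue (residue a)) [in RHS](cardsD1 a) inE eqxx /=.
  apply: eq_card => i; rewrite !inE.
  have [ri|_] := boolP (residue i == residue a); last by rewrite andbF.
  by rewrite sE // c0 andbT; case: (i == a).
rewrite -(cards1 a); apply: eq_card => i; rewrite !inE.
case: (eqVneq i a) => [->|ia]; first by rewrite sE // c0 !eqxx.
by apply/andP=> -[ri]; rewrite sE // c0 (negPf ia).
Qed.

(** * Identification of the three classes *)

Lemma single_defect_necklaces :
  [set necklace_of (single_defect m c) | c : word t in [set c : word t | primitive c]] =
  [set N in necklaces m | K2N N == multiples m t.+1 :\ 0].
Proof.
apply/setP=> N; rewrite inE; apply/imsetP/andP=> [[c]|[/imsetP[w _ ->]]].
  rewrite inE => pc ->; rewrite K2N_necklace_of K2_single_defect pc.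
  by rewrite imset_f.
by rewrite K2N_necklace_of => /eqP/K2_necklace[c pc ->]; exists c; rewrite ?inE.
Qed.

Lemma deltaN_K2N N : N \in necklaces m -> K2N N = multiples m t.+1 :\ 0 -> deltaN N = 2%N.
Proof.
move=> Nn KN; have: N \in [set N in necklaces m | K2N N == multiples m t.+1 :\ 0].
  by rewrite inE Nn KN eqxx.
rewrite -single_defect_necklaces => /imsetP[c]; rewrite inE => pc ->.
by rewrite deltaN_necklace_of delta_single_defect.
Qed.

Lemma necklace_single_defect_inj c c' :
  necklace_of (single_defect m c) = necklace_of (single_defect m c') -> c = c'.
Proof.
move=> E; have := mem_necklace_of (single_defect m c').
rewrite -E => /imsetP[k _ kE]; have k0 := single_defect_rotw (esym kE).
by apply: single_defect_inj; rewrite kE k0 rotw0.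
Qed.

Lemma card_multiples0 : #|multiples m t.+1 :\ 0| = M.-1.
Proof.
have -> : multiples m t.+1 = [set i | residue i == 0].
  by apply/setP=> i; rewrite multiplesE inE.
by rewrite -(card_residue 0) [in RHS](cardsD1 0) inE residue0 eqxx.
Qed.

(** From 3k = 0 modulo n = 3 tau it follows that tau divides [k]; the resulting inclusion is an
    equality because both sets have two elements. *)
Lemma order3_multiples k : M = 3%N -> #[k]%g = 3%N -> [set k; - k] = multiples m t.+1 :\ 0.
Proof.
move=> M3 ok; have k3 : (t.+1 %| k)%N.
  have : k *+ 3 == 0 by rewrite -FinRing.zmodXgE -ok expg_order.
  rewrite Zp_mulrn -val_eqE -[_ == _]/(m.+1 %| k * 3)%N [X in (X %| _)%N]nE M3 mulnC.
  by rewrite dvdn_pmul2r.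
have k0 : k != 0 by apply/eqP=> k0; rewrite k0 (order1 _) in ok.
have kN : k != - k.
  apply/negP; rewrite -subr_eq0 opprK -mulr2n -FinRing.zmodXgE => k2.
  by have := k2; rewrite -order_dvdn ok.
apply/eqP; rewrite eqEcard card_multiples0 M3 cards2 kN andbT.
apply/subsetP=> i; rewrite !inE multiplesE => /orP[]/eqP->.
  by rewrite k0 residue_eq0.
by rewrite oppr_eq0 k0 -[- k]sub0r residueB residue0 sub0r oppr_eq0 residue_eq0.
Qed.

Lemma D2SP3E : M = 3%N ->
  D2SP3 m = [set N in necklaces m | K2N N == multiples m t.+1 :\ 0].
Proof.
move=> M3; apply/setP=> N; rewrite !inE; case Nn: (N \in necklaces m) => //=.
apply/andP/eqP=> [[_ /existsP[k /and4P[_ _ /eqP-> /eqP ok]]]|KN].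
  exact: order3_multiples.
have sE : step = t.+1 :> nat by rewrite /= modn_small // nE ltn_Pmull // M3.
have os : #[step]%g = 3%N.
  apply: nt_prime_order => //; last exact: step_neq0.
  rewrite FinRing.zmodXgE Zp_mulrn; apply: val_inj.
  by rewrite [LHS]/= modnMml [X in (_ %% X)%N]nE M3 mulnC modnn.
split; first by rewrite deltaN_K2N.
(* The witness is tau itself, which has order 3 and lies below n/2 because n = 3 tau. *)
apply/existsP; exists step; rewrite KN -(order3_multiples M3 os) eqxx os eqxx.
by rewrite sE nE M3 /=; lia.
Qed.

(** For even M, n/2 = (M/2) tau is a nonzero multiple of tau, so the equality for [K2N] brings the
    membership of n/2 with it. *)
Lemma D2HTE : ~~ odd M ->
  D2HT m t.+1 = [set N in necklaces m | K2N N == multiples m t.+1 :\ 0].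
Proof.
move=> evM; apply/setP=> N; rewrite [RHS]inE [LHS]inE [N \in D2 m]inE.
have [Nn|//] := boolP (N \in necklaces m).
have [KN|_] := eqVneq (K2N N) _; last by rewrite !andbF.
have oddn : odd m.+1 = false by rewrite nE oddM (negPf evM).
have hE : (m.+1)./2 = (M./2 * t.+1)%N.
  by rewrite [in LHS]nE -{1}(even_halfK evM) -doubleMl doubleK.
have h0 : inZp (m.+1)./2 != 0 :> 'I_m.+1.
  have n3 : (2 < m.+1)%N by rewrite nE; nia.
  by rewrite -[_ != _]/((m.+1)./2 %% m.+1 != 0)%N modn_small; lia.
have tau_h : (t.+1 %| (m.+1)./2)%N by rewrite hE dvdn_mull.
have rh : residue (inZp (m.+1)./2) == 0.
  by rewrite residue_eq0 /dvdn modn_dvdm.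
by rewrite deltaN_K2N // oddn KN in_setD1 h0 multiplesE rh tau_h !eqxx.
Qed.

(** The count is M - 1 > 2. When n is even, n/2 = q tau would give M = 2q, against the oddness of
    M. *)
Lemma D2SUBE : odd M -> (4 < M)%N ->
  D2SUB m t.+1 = [set N in necklaces m | K2N N == multiples m t.+1 :\ 0].
Proof.
move=> oM M5; apply/setP=> N; rewrite [RHS]inE [LHS]inE [N \in D2 m]inE.
have [Nn|//] := boolP (N \in necklaces m).
have [KN|_] := eqVneq (K2N N) _; last by rewrite !andbF.
rewrite deltaN_K2N // KN card_multiples0 in_setD1 multiplesE residue_eq0.
apply/and4P; split=> //; first by rewrite ltn_predRL ltnW.
apply/implyP=> ev; rewrite negb_and; apply/orP; right.
rewrite /dvdn modn_dvdm //; apply/negP=> /dvdnP[q hq].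
have : (q.*2 * t.+1)%N = (M * t.+1)%N by rewrite -doubleMl -hq even_halfK // nE.
by move/eqP; rewrite eqn_pmul2r // => /eqP ME; rewrite -ME odd_double in oM.
Qed.

End Fibers.

Theorem theorem5p5 (m t : nat) :
  let n := m.+1 in
  let tau := t.+1 in
  let M := (n %/ tau)%N in
  (tau %| n)%N ->
  [\/ M = 3%N, ~~ odd M /\ (4 <= M)%N | odd M /\ (5 <= M)%N] ->
  (* (a) *)
  (forall N : {set word m}, N \in necklaces m ->
     K2N N = multiples m tau :\ 0 ->
     [/\ deltaN N = 2%N,
         forall w : word m, w \in N ->
           exists2 O : {set 'I_m.+1}, active_orbits tau w = [set O]
             & #|[set i in O | w i]| = 1%N \/ #|[set i in O | w i]| = M.-1
       & exists w : word m,
           unique (fun w' : word m =>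
             w' \in N /\ exists c : word t, w' = single_defect m c) w /\
           exists c : word t,
             unique (fun c' : word t => w = single_defect m c') c /\
             primitive c]) /\
  (* (b) *)
  ({in [set c : word t | primitive c] &,
      injective (fun c => necklace_of (single_defect m c))} /\
   [set necklace_of (single_defect m c) | c : word t in
      [set c : word t | primitive c]] =
     if M == 3%N then D2SP3 m
     else if ~~ odd M then D2HT m tau else D2SUB m tau) /\
  (forall c c' : word t, primitive c -> primitive c' ->
     necklace_of (single_defect m c) = necklace_of (single_defect m c') ->
     c = c').

Proof.
move=> n tau M tau_n hM; have M3 : (2 < M)%N by case: hM => [->|[_ /ltnW]|[_ /ltnW/ltnW]].
split; last split; last by move=> c c' _ _; exact: necklace_single_defect_inj.
- move=> N Nn KN.
  have: N \in [set N in necklaces m | K2N N == multiples m tau :\ 0].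
    by rewrite inE Nn KN eqxx.
  rewrite -single_defect_necklaces // => /imsetP[c]; rewrite inE => pc NE.
  split; first exact: deltaN_K2N KN.
    move=> w; rewrite NE => /imsetP[a _ ->].
    exists [set i | residue t i == residue t a].
      exact: active_orbits_rotw_single_defect.
    exact: card_ones_active_orbit.
  exists (single_defect m c); split; last first.
    exists c; split=> //; split=> // c'; exact: single_defect_inj.
  split=> [|w [wN [c' wE]]].
    by split; [rewrite NE mem_necklace_of | exists c].
  (* Another normal form in the necklace is a rotation of the first by some [k], and comparing
     mismatches forces [k = 0]. *)
  move: wN; rewrite NE => /imsetP[k _ wk].
  by rewrite wk (single_defect_rotw tau_n M3 (esym (etrans (esym wE) wk))) ?rotw0.
split; first by move=> c c' _ _; exact: necklace_single_defect_inj.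
rewrite single_defect_necklaces //.
have [M3E|M3N] := eqVneq M 3%N; first by rewrite (D2SP3E tau_n M3).
case: hM => [M3E|[evM _]|[oM M5]]; first by rewrite M3E eqxx in M3N.
  by rewrite evM (D2HTE tau_n).
by rewrite oM (D2SUBE tau_n).
Qed.
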